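(* Let $(X,d)$ be a metric space and $(\phi_n)$ a sequence of functions $\phi_n:X\times X\to\mathbb{R}_+$. Let $\phi,\psi:X\times X\to\mathbb{R}_+$ be such that $\phi_n\nearrow\phi$ uniformly with a rate of convergence $\pi$ and such that $\psi\preceq^A\phi_n$ for all $n$ for some $A:\mathbb{N}\to\mathbb{N}$, where $\psi$ is uniformly weakly triangular with modulus $\theta:\mathbb{N}\to\mathbb{N}$. Assume that $X$ has a modulus of total $\phi$-boundedness $\gamma$, that $\alpha_G$ is a $G$-modulus for $G$, that $\beta_H$ is an $H$-modulus for $H$, and that $f:\mathbb{N}\to\mathbb{N}$ is nondecreasing with $f(n)\leq n$. Let $(x_n)\subseteq X$ be a sequence and let (1) $\chi$ be a modulus of uniform $(\phi_{2n})$-$(G,H)$-quasi-Fej\'er monotonicity w.r.t. $F$ and $(AF_k)$ for $(x_{2n})$ with errors $(\varepsilon_n)$, (2) $\xi$ be a Cauchy rate for $\sum\varepsilon_n<\infty$, (3) $\Phi$ be a $\liminf$-bound w.r.t. $F$ and $(AF_k)$ for $(x_{2f(n)})_n$, (4) $\kappa$ be a rate of divergence for $f$, (5) $\zeta$ be a modulus of uniform $(\phi_n)$-$(G,H)$-quasi-$f$-monotonicity w.r.t. $F$ and $(AF_k)$ for $(x_n)$ with errors $(\varepsilon_n)$. For $k\in\mathbb{N}$ put $b_k=\beta_H(A(\theta(k)))$, $r_k=4b_k+3$, $s_k=\beta_H(\alpha_G(r_k))$, $K_k=\max\{2\alpha_G(r_k)+1,\,2\alpha_G(2s_k+1)+1\}$,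 $P=\gamma(K_k)$ and $$\hat k=\max\{\kappa(\xi(4s_k+3)),\ \xi(2b_k+1),\ \kappa(\xi(2b_k+1)),\ \kappa(\pi(K_k))\}.$$ For $g:\mathbb{N}\to\mathbb{N}$ put $$\eta(n,r)=\max\Big\{\chi\big(n,\lfloor g(2n)/2\rfloor,r\big),\ \zeta\big(n,\lfloor g(2n)/2\rfloor,r\big),\ \chi\big(f(n),n-f(n),4\beta_H(\alpha_G(r))+3\big)\Big\},$$ $\eta^M(n,r)=\max\{\eta(i,r)\mid i\leq n\}$, and $\Psi_0(0,k,g)=0$, $\Psi_0(n+1,k,g)=\Phi(\eta^M(\Psi_0(n,k,g),r_k),\hat k)$. Let $\Psi(k,g)=2\Psi_0(P,k,g)$. Then $(x_n)$ is $\psi$-Cauchy with rate of metastability $\Psi$, i.e. for all $k\in\mathbb{N}$ and $g:\mathbb{N}\to\mathbb{N}$: $$\exists N\leq\Psi(k,g)\ \forall i,j\in[N;N+g(N)]\ \Big(\psi(x_i,x_j)\leq\tfrac{1}{k+1}\Big).$$ If $\psi$ is uniformly triangular with modulus $\theta$, then $(x_n)$ is Cauchy with the same rate of metastability $\Psi$, i.e. the displayed statement holds with $d(x_i,x_j)$ in place of $\psi(x_i,x_j)$.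
   Context: $\mathbb{N}=\{0,1,2,\dots\}$, $\mathbb{R}_+=[0,\infty)$, $[a;b]=\{a,a+1,\dots,b\}$ for $a\le b$ in $\mathbb{N}$. Throughout, $G,H:\mathbb{R}_+\to\mathbb{R}_+$; $F\subseteq X$ is nonempty and $F=\bigcap_{k}AF_k$ for sets $AF_k\subseteq X$ with $AF_k\supseteq AF_{k+1}$; $(\varepsilon_n)\subseteq\mathbb{R}_+$ with $\sum\varepsilon_n<\infty$. All moduli are functions with natural number arguments and values. - $\pi$ is a rate of convergence for $\phi_n\nearrow\phi$ uniformly: $\forall k\,\forall n\geq\pi(k)\,\forall x,y\in X\ (\phi_n(x,y)\leq\phi(x,y)+\frac1{k+1})$. - $\psi\preceq^A\phi$: $\phi(x,y)\leq\frac1{A(k)+1}\to\psi(x,y)\leq\frac1{k+1}$ for all $k\in\mathbb{N}$, $x,y\in X$. - $\psi$ is uniformly weakly triangular with modulus $\theta$: for all $k$, $x,y,z$: $\psi(y,x),\psi(y,z)\leq\frac1{\theta(k)+1}\to\psi(x,z)\leq\frac1{k+1}$. It is uniformly triangular with modulus $\theta$ if under the same premise $d(x,z)\leq\frac1{k+1}$. - $\gamma$ is a modulus of total $\phi$-boundedness for $X$: for all $k$ and all sequences $(y_n)\subseteq X$ there are $0\leq i<j\leq\gamma(k)$ with $\phi(y_j,y_i)\leq\frac1{k+1}$. - $G$-modulus $\alpha_G$: $a\leq\frac1{\alpha_G(k)+1}\to G(a)\leq\frac1{k+1}$; $H$-modulus $\beta_H$: $H(a)\leq\frac1{\beta_H(k)+1}\to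 a\leq\frac1{k+1}$ (all $k\in\mathbb{N}$, $a\in\mathbb{R}_+$). - $\chi$ is a modulus of uniform $(\phi_n)$-$(G,H)$-quasi-Fej\'er monotonicity w.r.t. $F$ and $(AF_k)$ for $(y_n)$ with errors $(\varepsilon_n)$: for all $n,m,r\in\mathbb{N}$, all $p\in AF_{\chi(n,m,r)}$ and all $l\leq m$: $H(\phi_{n+l}(p,y_{n+l}))<G(\phi_n(p,y_n))+\sum_{i=n}^{n+l-1}\varepsilon_i+\frac1{r+1}$. (In (1): $y_n=x_{2n}$ and distances $\phi_{2n}$.) - $\zeta$ is a modulus of uniform $(\phi_n)$-$(G,H)$-quasi-$f$-monotonicity w.r.t. $F$ and $(AF_k)$ for $(x_n)$ with errors $(\varepsilon_n)$: for all $n,m,r$, all $p\in AF_{\zeta(n,m,r)}$ and all $l\leq m$: $H(\phi_{2(n+l)+1}(p,x_{2(n+l)+1}))<G(\phi_{2f(n)}(p,x_{2f(n)}))+\sum_{i=f(n)}^{n+l}\varepsilon_i+\frac1{r+1}$. - Cauchy rate $\xi$: $\sum_{i=\xi(k)}^\infty\varepsilon_i\leq\frac1{k+1}$ for all $k$. - $\Phi$ is a $\liminf$-bound w.r.t. $F$ and $(AF_k)$ for $(y_n)$: $\forall k,n\,\exists N\in[n;\Phi(k,n)]\,(y_N\in AF_k)$; $\Phi$ is always assumed nondecreasing in both arguments. - $\kappa$ is a rate of divergence for $f$: $\forall L\,\forall n\geq\kappa(L)\,(f(n)\geq L)$. - $(x_n)$ is $\psi$-Cauchy if $\forall k\,\exists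 N\,\forall i,j\geq N\,(\psi(x_i,x_j)\leq\frac1{k+1})$. *)

(* Defs.v *)
From HB Require Import structures.
From mathcomp Require Import all_boot all_order all_algebra.
From mathcomp Require Import all_classical all_reals all_analysis.

Set Implicit Arguments.
Unset Strict Implicit.
Unset Printing Implicit Defensive.
Import Order.TTheory GRing.Theory Num.Theory.
Import numFieldNormedType.Exports.

Local Open Scope classical_set_scope.
Local Open Scope ring_scope.

(* [0, +oo) is the type {nonneg R}; an error bound 1/(k+1) is k.+1%:R^-1. *)

Definition approximating (X : Type) (F : set X) (AF : nat -> set X) : Prop :=
  F !=set0 /\ F = \bigcap_k AF k /\ forall k, AF k.+1 `<=` AF k.

(* The relation written "phi_n increases to phi uniformly" constrains phi_n
   from above only; neither monotonicity in n nor actual convergence of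
   phi_n is part of it. *)
Definition upper_convergence_rate (R : realType) (X : Type)
    (phi_ : nat -> X -> X -> {nonneg R}) (phi : X -> X -> {nonneg R})
    (pi_ : nat -> nat) : Prop :=
  forall k n, (pi_ k <= n)%N -> forall x y,
    (phi_ n x y)%:num <= (phi x y)%:num + k.+1%:R^-1.

Definition dominated_with (R : realType) (X : Type) (A : nat -> nat)
    (psi phi : X -> X -> {nonneg R}) : Prop :=
  forall k x y, (phi x y)%:num <= (A k).+1%:R^-1 ->
    (psi x y)%:num <= k.+1%:R^-1.

Definition uniformly_weakly_triangular (R : realType) (X : Type)
    (psi : X -> X -> {nonneg R}) (theta : nat -> nat) : Prop :=
  forall k x y z,
    (psi y x)%:num <= (theta k).+1%:R^-1 ->
    (psi y z)%:num <= (theta k).+1%:R^-1 ->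
    (psi x z)%:num <= k.+1%:R^-1.

Definition uniformly_triangular (R : realType) (X : metricType R)
    (psi : X -> X -> {nonneg R}) (theta : nat -> nat) : Prop :=
  forall k (x y z : X),
    (psi y x)%:num <= (theta k).+1%:R^-1 ->
    (psi y z)%:num <= (theta k).+1%:R^-1 ->
    mdist x z <= k.+1%:R^-1.

Definition total_boundedness_modulus (R : realType) (X : Type)
    (phi : X -> X -> {nonneg R}) (gamma : nat -> nat) : Prop :=
  forall k (y : nat -> X), exists i j : nat,
    [/\ (i < j)%N, (j <= gamma k)%N & (phi (y j) (y i))%:num <= k.+1%:R^-1].

Definition G_modulus (R : realType) (G : {nonneg R} -> {nonneg R})
    (alphaG : nat -> nat) : Prop :=
  forall k (a : {nonneg R}),
    a%:num <= (alphaG k).+1%:R^-1 -> (G a)%:num <= k.+1%:R^-1.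

Definition H_modulus (R : realType) (H : {nonneg R} -> {nonneg R})
    (betaH : nat -> nat) : Prop :=
  forall k (a : {nonneg R}),
    (H a)%:num <= (betaH k).+1%:R^-1 -> a%:num <= k.+1%:R^-1.

(* The set F occurs in the following notions only through AF. *)

Definition quasi_fejer_modulus (R : realType) (X : Type)
    (phi_ : nat -> X -> X -> {nonneg R}) (G H : {nonneg R} -> {nonneg R})
    (AF : nat -> set X) (y : nat -> X) (eps : nat -> {nonneg R})
    (chi : nat -> nat -> nat -> nat) : Prop :=
  forall n m r p, AF (chi n m r) p -> forall l, (l <= m)%N ->
    (H (phi_ (n + l)%N p (y (n + l)%N)))%:num <
    (G (phi_ n p (y n)))%:num
      + \sum_(n <= i < n + l) (eps i)%:num + r.+1%:R^-1.

Definition quasi_f_monotonicity_modulus (R : realType) (X : Type)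
    (phi_ : nat -> X -> X -> {nonneg R}) (G H : {nonneg R} -> {nonneg R})
    (f : nat -> nat) (AF : nat -> set X) (x : nat -> X)
    (eps : nat -> {nonneg R}) (zeta : nat -> nat -> nat -> nat) : Prop :=
  forall n m r p, AF (zeta n m r) p -> forall l, (l <= m)%N ->
    (H (phi_ (2 * (n + l) + 1)%N p (x (2 * (n + l) + 1)%N)))%:num <
    (G (phi_ (2 * f n)%N p (x (2 * f n)%N)))%:num
      + \sum_(f n <= i < (n + l).+1) (eps i)%:num + r.+1%:R^-1.

Definition cauchy_rate (R : realType) (eps : nat -> {nonneg R})
    (xi : nat -> nat) : Prop :=
  forall k,
    (\sum_(xi k <= i <oo) ((eps i)%:num)%:E <= ((k.+1%:R^-1 : R))%:E)%E.

Definition liminf_bound (X : Type) (AF : nat -> set X) (y : nat -> X)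
    (Phi : nat -> nat -> nat) : Prop :=
  (forall k n, exists N, (n <= N <= Phi k n)%N /\ AF k (y N)) /\
  (forall k k' n n', (k <= k')%N -> (n <= n')%N -> (Phi k n <= Phi k' n')%N).

Definition divergence_rate (f kappa : nat -> nat) : Prop :=
  forall L n, (kappa L <= n)%N -> (L <= f n)%N.

Definition psi_cauchy (R : realType) (X : Type) (psi : X -> X -> {nonneg R})
    (x : nat -> X) : Prop :=
  forall k, exists N, forall i j, (N <= i)%N -> (N <= j)%N ->
    (psi (x i) (x j))%:num <= k.+1%:R^-1.

Definition metastability_rate (R : realType) (X : Type) (rho : X -> X -> R)
    (x : nat -> X) (Psi : nat -> (nat -> nat) -> nat) : Prop :=
  forall k (g : nat -> nat), exists2 N, (N <= Psi k g)%N &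
    forall i j, (N <= i <= N + g N)%N -> (N <= j <= N + g N)%N ->
      rho (x i) (x j) <= k.+1%:R^-1.

Local Open Scope nat_scope.

Definition eta (alphaG betaH f : nat -> nat)
    (chi zeta : nat -> nat -> nat -> nat) (g : nat -> nat) (n r : nat) : nat :=
  maxn (chi n ((g (2 * n)) %/ 2) r)
    (maxn (zeta n ((g (2 * n)) %/ 2) r)
          (chi (f n) (n - f n) (4 * betaH (alphaG r) + 3))).

Definition running_max (e : nat -> nat -> nat) (n r : nat) : nat :=
  \max_(i < n.+1) e i r.

(* e stands for eta, r for r_k and khat for \hat k. *)
Fixpoint Psi0 (Phi e : nat -> nat -> nat) (r khat n : nat) : nat :=
  if n is n'.+1
  then Phi (running_max e (Psi0 Phi e r khat n') r) khat
  else 0.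

Definition Psi (pi_ A theta gamma alphaG betaH f xi kappa : nat -> nat)
    (chi zeta : nat -> nat -> nat -> nat) (Phi : nat -> nat -> nat)
    (k : nat) (g : nat -> nat) : nat :=
  let b := betaH (A (theta k)) in
  let r := 4 * b + 3 in
  let s := betaH (alphaG r) in
  let K := maxn (2 * alphaG r + 1) (2 * alphaG (2 * s + 1) + 1) in
  let P := gamma K in
  let khat := maxn (kappa (xi (4 * s + 3)))
                (maxn (xi (2 * b + 1))
                   (maxn (kappa (xi (2 * b + 1))) (kappa (pi_ K)))) in
  2 * Psi0 Phi (eta alphaG betaH f chi zeta g) r khat P.

(* Main.v *)
Require Import Defs.
From mathcomp Require Import all_boot all_order all_algebra.
From mathcomp Require Import all_classical all_reals all_analysis.
From mathcomp Require Import zify lra.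

Set Implicit Arguments.
Unset Strict Implicit.
Unset Printing Implicit Defensive.

Import Order.TTheory GRing.Theory Num.Theory.
Import numFieldNormedType.Exports.

Local Open Scope classical_set_scope.
Local Open Scope ring_scope.

(** The liminf bound supplies indices [N_0, N_1, ...] with
    [N_j <= Psi0 (j + 1)] such that [x_(2 f(N_j))] lies in the approximation
    [AF] demanded, through [eta], by every index up to [Psi0 j]; since [Psi0]
    is nondecreasing this includes all [N_i] with [i < j]. Total boundedness
    applied to the points [x_(2 f(N_j))] yields [i < j <= P] for which two of
    them are [phi]-close ([liminf_cluster]). Put [n = N_i] and
    [p = x_(2 f(N_j))]: the point [p] approximates [F] well enough for [n],
    and, as [f(n)] is large, it is also [phi_(2 f(n))]-close to [x_(2 f(n))].

    Monotonicity then transports this closeness ([fejer_block]): first along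
    the even indices from [2 f(n)] to [2n], next along the even indices of
    [2n, 2n + g(2n)], while the odd indices of that interval are reached
    directly from [2 f(n)]. Every step costs a tail of the errors and a small
    strict allowance, absorbed by the moduli of [G] and [H]. So all
    [x_i] with [i] in the interval are [psi]-close to the single point [p]
    ([block_near_point]), and triangularity compares them with one another.
    Cauchyness follows since a sequence that is not Cauchy defines a [g]
    refuting metastability. *)

(** * Reciprocals and tails of the errors *)

Lemma inv_double (R : realType) (m : nat) :
  (2 * m + 1).+1%:R^-1 = m.+1%:R^-1 / 2 :> R.
Proof.
by rewrite (_ : (2 * m + 1).+1 = m.+1 * 2)%N ?natrM ?invfM //; lia.
Qed.

Lemma inv_quadruple (R : realType) (m : nat) :
  (4 * m + 3).+1%:R^-1 = m.+1%:R^-1 / 4 :> R.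
Proof.
by rewrite (_ : (4 * m + 3).+1 = m.+1 * 4)%N ?natrM ?invfM //; lia.
Qed.

Lemma inv_succ_le (R : realType) (m n : nat) :
  (m <= n)%N -> n.+1%:R^-1 <= m.+1%:R^-1 :> R.
Proof. by move=> mn; rewrite lef_pV2 ?posrE ?ltr0n// ler_nat. Qed.

Lemma cauchy_rate_sum (R : realType) (eps : nat -> {nonneg R})
    (xi : nat -> nat) : cauchy_rate eps xi ->
  forall k m n, (xi k <= m)%N ->
  \sum_(m <= i < n) (eps i)%:num <= k.+1%:R^-1.
Proof.
move=> xiP k m n xim; have [nm|/ltnW mn] := leqP n m.
  by rewrite big_geq// invr_ge0 ler0n.
apply: (@le_trans _ _ (\sum_(xi k <= i < n) (eps i)%:num)).
  rewrite (big_cat_nat xim mn)/= lerDr.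
  by apply: sumr_ge0 => i _.
rewrite -lee_fin -sumEFin; apply: le_trans (xiP k).
by apply: nneseries_lim_ge => i _ _; rewrite lee_fin.
Qed.

(** * Clustering along the liminf bound *)

Lemma approximating_antitone (X : Type) (F : set X) (AF : nat -> set X) :
  approximating F AF -> forall m n, (m <= n)%N -> AF n `<=` AF m.
Proof.
move=> [_ [_ AFS]] m n /subnK <-; elim: (n - m)%N => [//|i IH] p.
by rewrite addSn => /AFS/IH.
Qed.

Lemma running_max_ge (e : nat -> nat -> nat) (i n r : nat) :
  (i <= n)%N -> (e i r <= running_max e n r)%N.
Proof.
by rewrite -ltnS => ilt; exact: (leq_bigmax (Ordinal ilt) (F := fun j => _)).
Qed.

Lemma running_max_homo (e : nat -> nat -> nat) (m n r : nat) :
  (m <= n)%N -> (running_max e m r <= running_max e n r)%N.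
Proof.
move=> mn; apply/bigmax_leqP => i _; apply: running_max_ge.
by apply: leq_trans mn; rewrite -ltnS.
Qed.

Lemma Psi0_homo (Phi e : nat -> nat -> nat) (r khat : nat) :
  (forall k k' n n', (k <= k')%N -> (n <= n')%N -> (Phi k n <= Phi k' n')%N) ->
  forall m n, (m <= n)%N -> (Psi0 Phi e r khat m <= Psi0 Phi e r khat n)%N.
Proof.
move=> PhiM m n mn; elim: n m mn => [|n IH] [|m]//= mn.
by apply: PhiM => //; apply/running_max_homo/IH.
Qed.

(** The points [y_(N_j)] approximate [F] ever better, so of two close ones
    the later is good enough for every demand [e] made at the index of the
    earlier; total boundedness finds the close pair among the first
    [gamma K + 1] of them. *)
Lemma liminf_cluster (R : realType) (X : Type) (F : set X)
    (AF : nat -> set X) (phi : X -> X -> {nonneg R}) (gamma : nat -> nat)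
    (y : nat -> X) (Phi : nat -> nat -> nat) :
  approximating F AF -> total_boundedness_modulus phi gamma ->
  liminf_bound AF y Phi ->
  forall (e : nat -> nat -> nat) (r khat K : nat), exists n m,
    [/\ (khat <= n <= Psi0 Phi e r khat (gamma K))%N,
        AF (e n r) (y m) & (phi (y m) (y n))%:num <= K.+1%:R^-1].
Proof.
move=> AFP gammaP [PhiP PhiM] e r khat K.
have /choice[N NP] j := PhiP (running_max e (Psi0 Phi e r khat j) r) khat.
have [i [j [ij jK phiji]]] := gammaP K (y \o N).
have [/andP[khi iN] _] := NP i; have [_ AFj] := NP j.
have Nij : (N i <= Psi0 Phi e r khat j)%N.
  by apply: leq_trans iN _; exact: (@Psi0_homo _ _ _ _ PhiM i.+1).
exists (N i), (N j); split => //.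
  by rewrite khi (leq_trans Nij)// Psi0_homo.
by apply: (approximating_antitone AFP _ AFj); exact: running_max_ge.
Qed.

(** * Transport of closeness along the sequence *)

Section Transport.
Variables (R : realType) (X : Type) (G H : {nonneg R} -> {nonneg R}).
Variables (F : set X) (AF : nat -> set X) (eps : nat -> {nonneg R}).
Variables (phi_ : nat -> X -> X -> {nonneg R}) (alphaG betaH : nat -> nat).
Variables (f : nat -> nat) (x : nat -> X) (chi zeta : nat -> nat -> nat -> nat).
Variable xi : nat -> nat.
Hypotheses (AFP : approximating F AF) (alphaGP : G_modulus G alphaG).
Hypotheses (betaHP : H_modulus H betaH) (f_le : forall n, (f n <= n)%N).
Hypothesis chiP : quasi_fejer_modulus (fun n => phi_ (2 * n)%N) G H AF
  (fun n => x (2 * n)%N) eps chi.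
Hypothesis xiP : cauchy_rate eps xi.
Hypothesis zetaP : quasi_f_monotonicity_modulus phi_ G H f AF x eps zeta.

(** The bound [1 / (b + 1)] on [H] is split as a quarter for [G], a half for
    the error tail and a quarter for the allowance. The closeness required at
    [2 f(n)] is of two kinds: the first feeds the odd indices, the second is
    used to move from [2 f(n)] to [2n], where the even block starts. *)
Lemma fejer_block (g : nat -> nat) (q n : nat) (p : X) :
  let b := betaH q in
  let r := (4 * b + 3)%N in
  let s := betaH (alphaG r) in
  let d := phi_ (2 * f n)%N p (x (2 * f n)%N) in
  AF (eta alphaG betaH f chi zeta g n r) p ->
  d%:num <= (alphaG r).+1%:R^-1 ->
  d%:num <= (alphaG (2 * s + 1)%N).+1%:R^-1 ->
  (xi (4 * s + 3) <= f n)%N ->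
  (xi (2 * b + 1) <= n)%N -> (xi (2 * b + 1) <= f n)%N ->
  forall i, (2 * n <= i <= 2 * n + g (2 * n))%N ->
    (phi_ i p (x i))%:num <= q.+1%:R^-1.
Proof.
move=> b r s d AFp /alphaGP Gr /alphaGP Gs xis xin xif i /andP[ni ig].
have le_AF c : (c <= eta alphaG betaH f chi zeta g n r)%N -> AF c p.
  by move=> ce; exact: (approximating_antitone AFP ce).
pose m := (g (2 * n) %/ 2)%N.
have Gn : (G (phi_ (2 * n)%N p (x (2 * n)%N)))%:num <= r.+1%:R^-1.
  apply/alphaGP/betaHP; rewrite -/s.
  have AFc : AF (chi (f n) (n - f n) (4 * s + 3))%N p.
    by apply: le_AF; rewrite /eta !leq_max leqnn !orbT.
  have /= := chiP AFc (leqnn _); rewrite subnKC// => /ltW/le_trans; apply.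
  have := cauchy_rate_sum xiP n xis.
  by move: Gs; rewrite -/d inv_double inv_quadruple; move: (_^-1) => w; lra.
have lm : (i %/ 2 - n <= m)%N by rewrite /m; lia.
have nl : (n + (i %/ 2 - n) = i %/ 2)%N by lia.
apply: betaHP; rewrite -/b.
have [iodd|ieven] := boolP (odd i).
- have AFc : AF (zeta n m r) p.
    by apply: le_AF; rewrite /eta !leq_max leqnn !orbT.
  have := zetaP AFc lm; rewrite nl (_ : 2 * (i %/ 2) + 1 = i)%N; last by lia.
  move/ltW/le_trans; apply.
  have := cauchy_rate_sum xiP (i %/ 2).+1 xif.
  by move: Gr; rewrite -/d inv_double inv_quadruple; move: (_^-1) => w; lra.
- have AFc : AF (chi n m r) p.
    by apply: le_AF; rewrite /eta !leq_max leqnn.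
  have /= := chiP AFc lm; rewrite nl (_ : 2 * (i %/ 2) = i)%N; last by lia.
  move/ltW/le_trans; apply.
  have := cauchy_rate_sum xiP (i %/ 2) xin.
  by move: Gn; rewrite inv_double inv_quadruple; move: (_^-1) => w; lra.
Qed.

Variables (phi psi : X -> X -> {nonneg R}) (pi_ A theta gamma : nat -> nat).
Variables (Phi : nat -> nat -> nat) (kappa : nat -> nat).
Hypothesis piP : upper_convergence_rate phi_ phi pi_.
Hypothesis AP : forall n, dominated_with A psi (phi_ n).
Hypothesis gammaP : total_boundedness_modulus phi gamma.
Hypothesis PhiP : liminf_bound AF (fun n => x (2 * f n)%N) Phi.
Hypothesis kappaP : divergence_rate f kappa.

(** The constant [K] is such that the clustering error and the error of
    replacing [phi] by [phi_(2 f(n))], each at most [1 / (K + 1)], together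
    meet both closeness requirements at [2 f(n)]. *)
Lemma block_near_point (k : nat) (g : nat -> nat) :
  exists2 N,
    (N <= Psi pi_ A theta gamma alphaG betaH f xi kappa chi zeta Phi k g)%N &
    exists p, forall i, (N <= i <= N + g N)%N ->
      (psi p (x i))%:num <= (theta k).+1%:R^-1.
Proof.
rewrite /Psi; set b := betaH _; set r := (4 * b + 3)%N.
set s := betaH (alphaG r); set K := maxn (2 * alphaG r + 1) _.
set khat := maxn _ _; set e := eta _ _ _ _ _ _.
have [n [j [/andP[khn nPsi] AFp close]]] :=
  liminf_cluster AFP gammaP PhiP e r khat K.
move: khn; rewrite /khat !geq_max.
move=> /and4P[/kappaP xis xin /kappaP xif /kappaP pif].
exists (2 * n)%N; first by rewrite leq_mul2l nPsi orbT.
set p := x _ in AFp close; exists p => i ni.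
suff: (phi_ i p (x i))%:num <= (A (theta k)).+1%:R^-1.
  exact: AP.
have d_le : (phi_ (2 * f n)%N p (x (2 * f n)%N))%:num <= K.+1%:R^-1 * 2.
  have /piP/(_ p (x (2 * f n)%N)) : (pi_ K <= 2 * f n)%N by lia.
  by move: close => /=; move: (_^-1) => w; lra.
have half_K c : (2 * c + 1 <= K)%N -> K.+1%:R^-1 * 2 <= c.+1%:R^-1 :> R.
  by move=> /(@inv_succ_le R); rewrite inv_double ler_pdivlMr.
apply: fejer_block AFp _ _ _ _ _ i ni => //.
- by apply: le_trans d_le _; apply: half_K; rewrite leq_max leqnn.
- by apply: le_trans d_le _; apply: half_K; rewrite leq_max leqnn orbT.
Qed.

Lemma triangular_metastability (rho : X -> X -> R) :
  (forall k u v w, (psi v u)%:num <= (theta k).+1%:R^-1 ->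
     (psi v w)%:num <= (theta k).+1%:R^-1 -> rho u w <= k.+1%:R^-1) ->
  metastability_rate rho x
    (Psi pi_ A theta gamma alphaG betaH f xi kappa chi zeta Phi).
Proof.
move=> tri k g; have [N NPsi [p pP]] := block_near_point k g.
by exists N => // i j /pP pi /pP; exact: tri.
Qed.

End Transport.

(** * From metastability to Cauchyness *)

(** If no [N] works for [k], every [N] has counterexample indices beyond it;
    let [g N] reach both of them. *)
Lemma metastability_cauchy (R : realType) (X : Type) (rho : X -> X -> R)
    (x : nat -> X) (Psi_ : nat -> (nat -> nat) -> nat) :
  metastability_rate rho x Psi_ ->
  forall k, exists N, forall i j, (N <= i)%N -> (N <= j)%N ->
    rho (x i) (x j) <= k.+1%:R^-1.
Proof.
move=> meta k; apply: contrapT => /forallNP bad.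
have /choice[h hP] N : exists ij : nat * nat,
    [/\ (N <= ij.1)%N, (N <= ij.2)%N &
        ~ rho (x ij.1) (x ij.2) <= k.+1%:R^-1].
  have /existsNP[i /existsNP[j /not_implyP[Ni /not_implyP[Nj far]]]] := bad N.
  by exists (i, j).
have [N _ close] := meta k (fun N => (h N).1 + (h N).2)%N.
by have [N1 N2] := hP N; apply; apply: close; lia.
Qed.

Lemma mdist_cauchy (R : realType) (X : metricType R) (x : nat -> X) :
  (forall k, exists N, forall i j, (N <= i)%N -> (N <= j)%N ->
    mdist (x i) (x j) <= k.+1%:R^-1) ->
  cauchy (x @ \oo).
Proof.
move=> xC; apply: cauchy_exP => e /ltr_add_invr[k]; rewrite add0r => ke.
have [N NP] := xC k; exists (x N); exists N => // i /= Ni.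
by rewrite ballEmdist/=; apply: le_lt_trans ke; exact: NP.
Qed.

(** * The rate of metastability *)

Theorem theorem4p22 (R : realType) (X : metricType R)
    (G H : {nonneg R} -> {nonneg R})
    (F : set X) (AF : nat -> set X) (hF : approximating F AF)
    (eps : nat -> {nonneg R})
    (heps : (\sum_(0 <= i <oo) ((eps i)%:num)%:E < +oo)%E)
    (phi_ : nat -> X -> X -> {nonneg R}) (phi psi : X -> X -> {nonneg R})
    (pi_ : nat -> nat) (hpi : upper_convergence_rate phi_ phi pi_)
    (A : nat -> nat) (hA : forall n, dominated_with A psi (phi_ n))
    (theta : nat -> nat) (htheta : uniformly_weakly_triangular psi theta)
    (gamma : nat -> nat) (hgamma : total_boundedness_modulus phi gamma)
    (alphaG : nat -> nat) (halphaG : G_modulus G alphaG)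
    (betaH : nat -> nat) (hbetaH : H_modulus H betaH)
    (f : nat -> nat) (hf : forall m n, (m <= n)%N -> (f m <= f n)%N)
    (hfn : forall n, (f n <= n)%N)
    (x : nat -> X)
    (chi : nat -> nat -> nat -> nat)
    (hchi : quasi_fejer_modulus (fun n => phi_ (2 * n)%N) G H AF
              (fun n => x (2 * n)%N) eps chi)
    (xi : nat -> nat) (hxi : cauchy_rate eps xi)
    (Phi : nat -> nat -> nat)
    (hPhi : liminf_bound AF (fun n => x (2 * f n)%N) Phi)
    (kappa : nat -> nat) (hkappa : divergence_rate f kappa)
    (zeta : nat -> nat -> nat -> nat)
    (hzeta : quasi_f_monotonicity_modulus phi_ G H f AF x eps zeta) :
  let Psi_ := Psi pi_ A theta gamma alphaG betaH f xi kappa chi zeta Phi in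
  (psi_cauchy psi x /\
   metastability_rate (fun u v => (psi u v)%:num) x Psi_) /\
  (uniformly_triangular psi theta ->
   cauchy (x @ \oo) /\ metastability_rate (@mdist R X) x Psi_).
Proof.
move=> Psi_.
have meta rho := @triangular_metastability R X G H F AF eps phi_ alphaG betaH f
  x chi zeta xi hF halphaG hbetaH hfn hchi hxi hzeta phi psi pi_ A theta gamma
  Phi kappa hpi hA hgamma hPhi hkappa rho.
have psi_meta : metastability_rate (fun u v => (psi u v)%:num) x Psi_.
  by apply: meta => k u v w; exact: htheta.
split; first by split => //; exact: metastability_cauchy psi_meta.
move=> tri; have d_meta : metastability_rate (@mdist R X) x Psi_.
  by apply: meta => k u v w; exact: tri.
by split => //; apply/mdist_cauchy/(metastability_cauchy d_meta).
Qed.
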